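(* Let $R$ be an associative ring with $1$, $\mathcal K$ a class of right $R$-modules, and $M$ a left $R$-module that is the union of an $\omega$-closed directed system $\mathcal C$ of submodules of $M$ each of which is $\mathcal K$-Mittag-Leffler. Then $M$ is $\mathcal K$-Mittag-Leffler.
   Context: A left module $M$ is $\mathcal K$-Mittag-Leffler if the canonical map $(\prod_I N_i)\otimes M\to\prod_I(N_i\otimes M)$ is injective for every family $(N_i)_{i\in I}$ of members of $\mathcal K$. A directed system of submodules of $M$ is a family $\mathcal C$ of submodules, upward directed by inclusion, the connecting maps being the inclusions. It is $\omega$-closed if for every strictly ascending chain $C_0\subset C_1\subset C_2\subset\cdots$ (of order type $\omega$) of members of $\mathcal C$, its direct limit $\bigcup_{k<\omega}C_k$ (as a module) is itself a member of $\mathcal C$. *)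

(* Defs.v *)
From HB Require Import structures.
From mathcomp Require Import all_boot all_algebra.
From mathcomp Require Import boolp.
From mathcomp Require Import freeg.

Set Implicit Arguments.
Unset Strict Implicit.
Unset Printing Implicit Defensive.

Import GRing.Theory.
Local Open Scope ring_scope.
Local Open Scope quotient_scope.

(* Conventions: R is an arbitrary associative ring with 1 (pzRingType, so the
   zero ring is allowed); left R-modules are lmodType R; right R-modules are
   left modules over the converse ring, lmodType R^c, where x r is written
   (r : R^c) *: x. *)

Section DependentProduct.
Variable I : Type.

Definition dprod (T : I -> Type) : Type := forall i, T i.

HB.instance Definition _ (T : I -> choiceType) :=
  Choice.copy (dprod T) (forall i, T i).

Section Zmod.
Variable V : I -> zmodType.
Local Notation P := (dprod V).

Definition dprod_zero : P := fun=> 0.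
Definition dprod_opp (f : P) : P := fun i => - f i.
Definition dprod_add (f g : P) : P := fun i => f i + g i.

Fact dprod_addA : associative dprod_add.
Proof. by move=> f g h; apply/functional_extensionality_dep => i; apply: addrA. Qed.
Fact dprod_addC : commutative dprod_add.
Proof. by move=> f g; apply/functional_extensionality_dep => i; apply: addrC. Qed.
Fact dprod_add0 : left_id dprod_zero dprod_add.
Proof. by move=> f; apply/functional_extensionality_dep => i; apply: add0r. Qed.
Fact dprod_addN : left_inverse dprod_zero dprod_opp dprod_add.
Proof. by move=> f; apply/functional_extensionality_dep => i; apply: addNr. Qed.

HB.instance Definition _ :=
  GRing.isZmodule.Build P dprod_addA dprod_addC dprod_add0 dprod_addN.
End Zmod.

Section Lmod.
Variables (A : pzRingType) (V : I -> lmodType A).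
Local Notation P := (dprod V).

Definition dprod_scale (a : A) (f : P) : P := fun i => a *: f i.

Fact dprod_scaleA a b f :
  dprod_scale a (dprod_scale b f) = dprod_scale (a * b) f.
Proof. by apply/functional_extensionality_dep => i; apply: scalerA. Qed.
Fact dprod_scale1 : left_id 1 dprod_scale.
Proof. by move=> f; apply/functional_extensionality_dep => i; apply: scale1r. Qed.
Fact dprod_scaleDr : right_distributive dprod_scale +%R.
Proof. by move=> a f g; apply/functional_extensionality_dep => i; apply: scalerDr. Qed.
Fact dprod_scaleDl f : {morph dprod_scale^~ f : a b / a + b}.
Proof. by move=> a b; apply/functional_extensionality_dep => i; apply: scalerDl. Qed.

HB.instance Definition _ := GRing.Zmodule_isLmodule.Build A P
  dprod_scaleA dprod_scale1 dprod_scaleDr dprod_scaleDl.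
End Lmod.
End DependentProduct.

Section Tensor.
Variables (R : pzRingType) (N : lmodType R^c) (M : lmodType R).

Definition tensor_free : zmodType := {freeg (N * M) / int}.

Variant tensor_relator : tensor_free -> Prop :=
| TensorAddl n n' m :
    tensor_relator (<< (n + n', m) >> - << (n, m) >> - << (n', m) >>)
| TensorAddr n m m' :
    tensor_relator (<< (n, m + m') >> - << (n, m) >> - << (n, m') >>)
| TensorScale n (r : R) m :
    tensor_relator (<< ((r : R^c) *: n, m) >> - << (n, r *: m) >>).

Definition tensor_rels : {pred tensor_free} := fun x =>
  `[< forall S : zmodClosed tensor_free,
        (forall y, tensor_relator y -> y \in S) -> x \in S >].

Fact tensor_rels_closed : zmod_closed tensor_rels.
Proof.
split; first by apply/asboolP => S _; apply: rpred0.
move=> x y /asboolP xS /asboolP yS; apply/asboolP => S hS.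
by apply: rpredB; [apply: xS | apply: yS].
Qed.

HB.instance Definition _ :=
  GRing.isZmodClosed.Build tensor_free tensor_rels tensor_rels_closed.

Definition tensor : Type := Quotient.quot tensor_rels.
HB.instance Definition _ := GRing.Zmodule.on tensor.

Definition pure (n : N) (m : M) : tensor :=
  \pi_(Quotient.quot tensor_rels) << (n, m) >>.

Definition balanced (A : zmodType) (f : N -> M -> A) : Prop :=
  [/\ forall n n' m, f (n + n') m = f n m + f n' m,
      forall n m m', f n (m + m') = f n m + f n m' &
      forall n (r : R) m, f ((r : R^c) *: n) m = f n (r *: m)].

Lemma pure_balanced : balanced pure.
Proof.
have piD (x y : tensor_free) : \pi_(Quotient.quot tensor_rels) x
    + \pi_(Quotient.quot tensor_rels) y
    = \pi_(Quotient.quot tensor_rels) (x + y) :> tensor by rewrite !piE.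
have rel x : tensor_relator x -> x \in tensor_rels.
  by move=> hx; apply/asboolP => S; apply.
split=> [n n' m|n m m'|n r m]; rewrite ?piD; apply/eqP.
- by rewrite -Quotient.idealrBE opprD addrA; exact/rel/TensorAddl.
- by rewrite -Quotient.idealrBE opprD addrA; exact/rel/TensorAddr.
- by rewrite -Quotient.idealrBE; exact/rel/TensorScale.
Qed.

(* Extension of f along pure, computed on a representative; it is independent
   of the representative, and the universal map, when f is balanced. *)
Definition tensor_lift (A : zmodType) (f : N -> M -> A) (x : tensor) : A :=
  fglift (fun nm : N * M => f nm.1 nm.2 : zmodule A)
    (repr (x : Quotient.quot tensor_rels)).

Section Lift.
Variables (A : zmodType) (f : N -> M -> A).
Hypothesis f_balanced : balanced f.

Let g : N * M -> zmodule A := fun nm => f nm.1 nm.2.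

Let gB (x y : tensor_free) : fglift g (x - y) = fglift g x - fglift g y.
Proof. exact: lift_is_additive. Qed.

Let g0 : fglift g (0 : tensor_free) = 0.
Proof. by rewrite -[0](subrr 0) gB subrr. Qed.

Let gD (x y : tensor_free) : fglift g (x + y) = fglift g x + fglift g y.
Proof. by rewrite -{1}[y]opprK -[- y]sub0r gB gB g0 sub0r opprK. Qed.

Let kerg : {pred tensor_free} := fun x => fglift g x == 0.

Let kerg_closed : zmod_closed kerg.
Proof.
split; first by rewrite unfold_in g0.
by move=> x y; rewrite !unfold_in gB => /eqP -> /eqP ->; rewrite subrr.
Qed.

Lemma tensor_lift_pi (x : tensor_free) :
  tensor_lift f (\pi_(Quotient.quot tensor_rels) x) = fglift g x.
Proof.
have gU nm : fglift g << nm >> = g nm by rewrite liftU scale1r.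
have [fDl fDr fZ] := f_balanced.
have rels_ker y : y \in tensor_rels -> fglift g y = 0.
  move=> /asboolP.
  pose K : zmodClosed tensor_free :=
    HB.pack_for (zmodClosed tensor_free) kerg
      (GRing.isZmodClosed.Build tensor_free kerg kerg_closed).
  move=> /(_ K) yK; apply/eqP; apply: yK => _ [n n' m|n m m'|n r m].
  - by rewrite unfold_in /= /kerg !gB !gU /g /= fDl -addrA -opprD subrr.
  - by rewrite unfold_in /= /kerg !gB !gU /g /= fDr -addrA -opprD subrr.
  - by rewrite unfold_in /= /kerg !gB !gU /g /= fZ subrr.
apply/eqP; rewrite -subr_eq0 /tensor_lift -gB; apply/eqP/rels_ker.
by rewrite Quotient.idealrBE reprK.
Qed.

Lemma tensor_lift_pure n m : tensor_lift f (pure n m) = f n m.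
Proof. by rewrite tensor_lift_pi liftU scale1r. Qed.

Lemma tensor_liftD : {morph tensor_lift f : x y / x + y}.
Proof.
move=> x y; rewrite -[x]reprK -[y]reprK.
by rewrite [X in tensor_lift f X](_ : _ = \pi_(Quotient.quot tensor_rels)
     (repr x + repr y)) ?tensor_lift_pi ?gD // !piE.
Qed.
End Lift.
End Tensor.

(* (prod_i N_i) (x) M -> prod_i (N_i (x) M), (n_i)_i (x) m |-> (n_i (x) m)_i *)
Definition tensor_prod_map (R : pzRingType) (I : Type) (N : I -> lmodType R^c)
    (M : lmodType R) : tensor (dprod N) M -> dprod (fun i => tensor (N i) M) :=
  tensor_lift (fun (n : dprod N) (m : M) =>
    (fun i => pure (n i) m) : dprod (fun i => tensor (N i) M)).

Section TensorProdMap.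
Variables (R : pzRingType) (I : Type) (N : I -> lmodType R^c) (M : lmodType R).

Let pure_prod_balanced : balanced (fun (n : dprod N) (m : M) =>
  (fun i => pure (n i) m) : dprod (fun i => tensor (N i) M)).
Proof.
split=> [n n' m|n m m'|n r m]; apply/functional_extensionality_dep => i.
- by have [+ _ _] := pure_balanced (N i) M; apply.
- by have [_ + _] := pure_balanced (N i) M; apply.
- by have [_ _ +] := pure_balanced (N i) M; apply.
Qed.

Lemma tensor_prod_map_pure (n : dprod N) (m : M) :
  tensor_prod_map (pure n m) = fun i => pure (n i) m.
Proof. exact: tensor_lift_pure. Qed.

Lemma tensor_prod_mapD : {morph @tensor_prod_map R I N M : x y / x + y}.
Proof. exact: tensor_liftD. Qed.
End TensorProdMap.

Definition Mittag_Leffler (R : pzRingType) (K : lmodType R^c -> Prop)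
    (M : lmodType R) : Prop :=
  forall (I : Type) (N : I -> lmodType R^c), (forall i, K (N i)) ->
    injective (@tensor_prod_map R I N M).

(* submodClosed M has boolean membership predicates; with the classical axioms
   of boolp these are all the submodules of M. *)
Section Submodules.
Variables (R : pzRingType) (M : lmodType R).

Section SubmoduleType.
Variable S : submodClosed M.
Definition submodule_type : Type := {x : M | x \in S}.
HB.instance Definition _ := SubChoice.on submodule_type.
HB.instance Definition _ := [SubChoice_isSubLmodule of submodule_type by <:].
End SubmoduleType.

Implicit Type C : submodClosed M -> Prop.

Definition directed_system C : Prop :=
  forall S T, C S -> C T ->
    exists U, [/\ C U, {subset S <= U} & {subset T <= U}].

(* Membership of the union in C is up to equality of subsets of M. *)
Definition omega_closed C : Prop :=
  forall S : nat -> submodClosed M,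
    (forall k, C (S k)) ->
    (forall k, {subset S k <= S k.+1} /\ ~ {subset S k.+1 <= S k}) ->
    exists2 U, C U & forall x, x \in U <-> exists k, x \in S k.

Definition is_union C : Prop := forall x : M, exists2 S, C S & x \in S.
End Submodules.

(* Main.v *)
From HB Require Import structures.
Require Import Defs.
From mathcomp Require Import all_boot all_algebra.
From mathcomp Require Import boolp freeg.

Set Implicit Arguments.
Unset Strict Implicit.
Unset Printing Implicit Defensive.

Import GRing.Theory.
Local Open Scope ring_scope.
Local Open Scope quotient_scope.

(** Let [z] represent an element of [(prod_i N_i) (x) M] that vanishes in every
    [N_i (x) M], and let [A S] be the set of those [i] for which [z] already
    vanishes in [N_i (x) S].  If [A S] is the whole index set for some [S] in
    [C] carrying [z], then [z = 0] because [S] is Mittag-Leffler.  Otherwise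
    directedness gives a chain [S_0 < S_1 < ...] in [C] along which [A] strictly
    increases.  Its union [U] is in [C] and hence Mittag-Leffler; applied to the
    subfamily indexed by [A U], this makes the restriction of [z] vanish over
    [U], and so already over some [S_k] because only finitely many relations are
    involved.  Thus [A S_k] contains [A U], contradicting strict increase. *)

(** * Additive maps out of free abelian groups *)

Section FreeExtension.
Variable T : choiceType.

(** An integer multiple of a generator is an iterated sum or its opposite, so closure under
    subtraction is enough; the cases match the rewriting rules of additive maps. *)
Lemma freeg_int_ind (P : {freeg T / int} -> Prop) :
  P 0 -> (forall x y, P x -> P y -> P (x - y)) -> (forall t, P << t >>) ->
  forall z, P z.
Proof.
move=> P0 PB PU; have PN x : P x -> P (- x) by rewrite -sub0r; exact: PB.
have PD x y : P x -> P y -> P (x + y).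
  by move=> Px Py; rewrite -[y]opprK; apply/PB/PN.
have PM x n : P x -> P (x *+ n).
  by move=> Px; elim: n => [|n IHn]; rewrite ?mulr0n // mulrS; apply: PD.
elim/freeg_ind_dom0 => // k x z _ _; apply: PD.
have -> : << k *g x >> = << x >> *~ k :> {freeg T / int}.
  by rewrite freegU_mulz intz.
by case: k => n; [|apply: PN]; apply: PM.
Qed.

Variables (A : zmodType) (g : T -> A).

(** [fglift] takes values in a module over the coefficient ring, so [A] is viewed through [zmodule]
    as a module over [int]. *)
Definition free_ext (z : {freeg T / int}) : A :=
  fglift (g : T -> zmodule A) z.

Fact free_ext_additive : zmod_morphism free_ext.
Proof. by move=> x y; exact: (@lift_is_additive _ _ (zmodule A)). Qed.

HB.instance Definition _ :=
  GRing.isZmodMorphism.Build {freeg T / int} A free_ext free_ext_additive.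

Lemma free_extU t : free_ext << t >> = g t.
Proof. by rewrite /free_ext liftU scale1r. Qed.

End FreeExtension.

(** * Tensor relations with second entries in a subset *)

Section Relations.
Variables (R : pzRingType) (N : lmodType R^c) (M : lmodType R).

(* The relations between tensors that involve only elements of [U]: their
   classes are the relations holding in [N (x) U] when [U] is a submodule. *)
Inductive rels_over (U : {pred M}) : tensor_free N M -> Prop :=
| rels_over0 : rels_over U 0
| rels_overB x y : rels_over U x -> rels_over U y -> rels_over U (x - y)
| rels_over_addl n n' m of m \in U :
    rels_over U (<< (n + n', m) >> - << (n, m) >> - << (n', m) >>)
| rels_over_addr n m m' of m \in U & m' \in U :
    rels_over U (<< (n, m + m') >> - << (n, m) >> - << (n, m') >>)
| rels_over_scale n (r : R) m of m \in U :
    rels_over U (<< ((r : R^c) *: n, m) >> - << (n, r *: m) >>).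

(** [tensor_rels] is the intersection of all subgroups containing the relators, and [P], made
    boolean classically, is one of these subgroups. *)
Lemma tensor_rels_ind (P : tensor_free N M -> Prop) :
  P 0 -> (forall x y, P x -> P y -> P (x - y)) ->
  (forall x, tensor_relator x -> P x) -> forall x, x \in @tensor_rels R N M -> P x.
Proof.
move=> P0 PB Prel x /asboolP.
pose Pb : {pred tensor_free N M} := fun y => `[< P y >].
have Pb_closed : zmod_closed Pb.
  split; first exact/asboolP.
  by move=> y y' /asboolP Py /asboolP Py'; apply/asboolP/PB.
pose S : zmodClosed (tensor_free N M) :=
  HB.pack_for (zmodClosed (tensor_free N M)) Pb
    (GRing.isZmodClosed.Build (tensor_free N M) Pb Pb_closed).
by move=> /(_ S) xS; apply/asboolP/xS => y /Prel Py; apply/asboolP.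
Qed.

Lemma tensor_relsP (x : tensor_free N M) :
  x \in @tensor_rels R N M <-> rels_over predT x.
Proof.
split=> [|xT].
  elim/tensor_rels_ind => {x} [|x y|x []*]; first exact: rels_over0.
  - exact: rels_overB.
  - exact: rels_over_addl.
  - exact: rels_over_addr.
  - exact: rels_over_scale.
apply/asboolP => S relS.
elim: xT => [|y y' _ yS _ y'S|n n' m _|n m m' _ _|n r m _].
- exact: rpred0.
- exact: rpredB.
- exact/relS/TensorAddl.
- exact/relS/TensorAddr.
- exact/relS/TensorScale.
Qed.

Lemma rels_over_sub (U V : {pred M}) z :
  {subset U <= V} -> rels_over U z -> rels_over V z.
Proof.
move=> UV; elim=> *.
- exact: rels_over0.
- exact: rels_overB.
- by apply: rels_over_addl; apply: UV.
- by apply: rels_over_addr; apply: UV.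
- by apply: rels_over_scale; apply: UV.
Qed.

Lemma pi_tensor_eq0 (z : tensor_free N M) :
  (\pi_(Quotient.quot (@tensor_rels R N M)) z = 0 :> tensor N M)
  <-> z \in @tensor_rels R N M.
Proof.
rewrite -[0]/(0 : Quotient.quot (@tensor_rels R N M)) -[z in z \in _]subr0.
by rewrite Quotient.idealrBE -pi_zeror; split=> [->|/eqP].
Qed.

End Relations.

(** * Functoriality in the right module, and maps between products *)

Section LeftMap.
Variables (R : pzRingType) (M : lmodType R).

Definition free_mapl (N N' : lmodType R^c) (f : N -> N') :
    tensor_free N M -> tensor_free N' M :=
  free_ext (fun nm : N * M => << (f nm.1, nm.2) >> : tensor_free N' M).

HB.instance Definition _ (N N' : lmodType R^c) (f : N -> N') :=
  GRing.Additive.on (free_mapl f).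

Lemma free_maplU (N N' : lmodType R^c) (f : N -> N') n m :
  free_mapl f << (n, m) >> = << (f n, m) >>.
Proof. exact: free_extU. Qed.

Lemma free_mapl_comp (N N' N'' : lmodType R^c) (f : N' -> N'') (g : N -> N') z :
  free_mapl f (free_mapl g z) = free_mapl (f \o g) z.
Proof.
elim/freeg_int_ind: z => [|x y IHx IHy|[n m]]; first by rewrite !raddf0.
  by rewrite !raddfB /= IHx IHy.
by rewrite !free_maplU.
Qed.

(** Second entries are left untouched, so each generating relation goes to one of the same kind over
    the same [U]. *)
Lemma rels_over_mapl (N N' : lmodType R^c) (f : {linear N -> N'})
    (U : {pred M}) z :
  rels_over U z -> rels_over U (free_mapl f z).
Proof.
elim=> [|x y _ IHx _ IHy|n n' m mU|n m m' mU mU'|n r m mU].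
- by rewrite raddf0; exact: rels_over0.
- by rewrite raddfB; exact: rels_overB.
- by rewrite !raddfB /= !free_maplU raddfD; exact: rels_over_addl.
- by rewrite !raddfB /= !free_maplU; exact: rels_over_addr.
- by rewrite !raddfB /= !free_maplU linearZ; exact: rels_over_scale.
Qed.

End LeftMap.

Section DependentProductMaps.
Variables (A : pzRingType) (I : Type) (V : I -> lmodType A).

Definition dprod_proj (i : I) (v : dprod V) : V i := v i.

Fact dprod_proj_linear i : linear (dprod_proj i).
Proof. by []. Qed.

HB.instance Definition _ i :=
  GRing.isLinear.Build A (dprod V) (V i) _ (dprod_proj i) (dprod_proj_linear i).

Definition dprod_reindex (J : Type) (h : J -> I) (v : dprod V) :
  dprod (V \o h) := fun j => v (h j).

Fact dprod_reindex_linear J (h : J -> I) : linear (@dprod_reindex J h).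
Proof. by []. Qed.

HB.instance Definition _ J (h : J -> I) :=
  GRing.isLinear.Build A (dprod V) (dprod (V \o h)) _ (@dprod_reindex J h)
    (@dprod_reindex_linear J h).

End DependentProductMaps.

(** * Passage between a submodule and the whole module *)

Section Submodule.
Variables (R : pzRingType) (N : lmodType R^c) (M : lmodType R).

Definition free_incl (S : submodClosed M) :
    tensor_free N (submodule_type S) -> tensor_free N M :=
  free_ext (fun nm : N * submodule_type S =>
    << (nm.1, \val nm.2) >> : tensor_free N M).

HB.instance Definition _ S := GRing.Additive.on (@free_incl S).

Lemma free_inclU S n (m : submodule_type S) :
  free_incl << (n, m) >> = << (n, \val m) >>.
Proof. exact: free_extU. Qed.

(* A retraction of [free_incl]; elements outside [S] are sent to 0. *)
Definition free_retr (S : submodClosed M) :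
    tensor_free N M -> tensor_free N (submodule_type S) :=
  free_ext (fun nm : N * M =>
    << (nm.1, insubd (0 : submodule_type S) nm.2) >>
      : tensor_free N (submodule_type S)).

HB.instance Definition _ S := GRing.Additive.on (@free_retr S).

Lemma free_retrU S n m :
  free_retr S << (n, m) >> = << (n, insubd (0 : submodule_type S) m) >>.
Proof. exact: free_extU. Qed.

Lemma free_inclK S : cancel (@free_incl S) (free_retr S).
Proof.
elim/freeg_int_ind => [|x y IHx IHy|[n m]]; first by rewrite !raddf0.
  by rewrite !raddfB /= IHx IHy.
by rewrite free_inclU free_retrU valKd.
Qed.

(** Second entries lie in [S], hence in [T], so [insubd] never falls back on its default 0. This
    moves formal sums from [S] to a larger [T]. *)
Lemma free_retrK (S T : submodClosed M) (z : tensor_free N (submodule_type S)) :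
  {subset S <= T} -> free_incl (free_retr T (free_incl z)) = free_incl z.
Proof.
move=> ST; elim/freeg_int_ind: z => [|x y IHx IHy|[n m]].
- by rewrite !raddf0.
- by rewrite !raddfB /= IHx IHy.
by rewrite !free_inclU free_retrU free_inclU insubdK //; apply/ST/valP.
Qed.

(** Although [insubd] is not linear on [M], it is so on [S], and relations over [S] have all their
    second entries there; hence the retraction preserves them. *)
Lemma rels_over_incl S (z : tensor_free N (submodule_type S)) :
  rels_over S (free_incl z) <-> z \in @tensor_rels R N (submodule_type S).
Proof.
split=> [zS|/tensor_relsP].
  rewrite -[z]free_inclK; apply/tensor_relsP.
  have insubdD m m' : m \in S -> m' \in S ->
      insubd (0 : submodule_type S) (m + m') = insubd 0 m + insubd 0 m'.
    by move=> mS mS'; apply: val_inj; rewrite raddfD /= !insubdK // rpredD.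
  have insubdZ (r : R) m : m \in S ->
      insubd (0 : submodule_type S) (r *: m) = r *: insubd 0 m.
    by move=> mS; apply: val_inj; rewrite linearZ /= !insubdK // rpredZ.
  elim: zS => [|x y _ IHx _ IHy|n n' m mS|n m m' mS mS'|n r m mS].
  - by rewrite raddf0; exact: rels_over0.
  - by rewrite raddfB; exact: rels_overB.
  - by rewrite !raddfB /= !free_retrU; exact: rels_over_addl.
  - by rewrite !raddfB /= !free_retrU insubdD //; exact: rels_over_addr.
  - by rewrite !raddfB /= !free_retrU insubdZ //; exact: rels_over_scale.
elim=> [|x y _ IHx _ IHy|n n' m _|n m m' _ _|n r m _].
- by rewrite raddf0; exact: rels_over0.
- by rewrite raddfB; exact: rels_overB.
- by rewrite !raddfB /= !free_inclU; apply: rels_over_addl; exact: valP.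
- rewrite !raddfB /= !free_inclU raddfD.
  by apply: rels_over_addr; exact: valP.
- by rewrite !raddfB /= !free_inclU linearZ; apply: rels_over_scale; exact: valP.
Qed.

End Submodule.

Lemma free_mapl_incl (R : pzRingType) (N N' : lmodType R^c) (M : lmodType R)
    (S : submodClosed M) (f : N -> N') (z : tensor_free N (submodule_type S)) :
  free_mapl f (free_incl z) = free_incl (free_mapl f z).
Proof.
elim/freeg_int_ind: z => [|x y IHx IHy|[n m]]; first by rewrite !raddf0.
  by rewrite !raddfB /= IHx IHy.
by rewrite free_inclU !free_maplU free_inclU.
Qed.

(** * Finiteness over directed unions *)

Section DirectedUnion.
Variables (R : pzRingType) (N : lmodType R^c) (M : lmodType R).
Variables (D : submodClosed M -> Prop) (U : {pred M}).
Hypothesis D_directed : directed_system D.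
Hypothesis U_sub : forall m, m \in U -> exists2 S, D S & m \in S.

(** A derivation uses finitely many second entries, and directedness gathers them in one member of
    [D]; [S0] settles the zero relation. *)
Lemma rels_over_directed (z : tensor_free N M) (S0 : submodClosed M) :
  D S0 -> rels_over U z -> exists2 S, D S & rels_over S z.
Proof.
move=> DS0.
elim=> [|x y _ [S DS xS] _ [T DT yT]|n n' m|n m m'|n r m].
- by exists S0 => //; exact: rels_over0.
- have [V [DV SV TV]] := D_directed DS DT.
  exists V => //; apply: rels_overB; first exact: rels_over_sub xS.
  exact: rels_over_sub yT.
- by move=> /U_sub[S DS mS]; exists S => //; exact: rels_over_addl.
- move=> /U_sub[S DS mS] /U_sub[T DT mT].
  have [V [DV SV TV]] := D_directed DS DT; exists V => //.
  by apply: rels_over_addr; [exact: SV|exact: TV].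
- by move=> /U_sub[S DS mS]; exists S => //; exact: rels_over_scale.
Qed.

End DirectedUnion.

Lemma free_incl_union (R : pzRingType) (N : lmodType R^c) (M : lmodType R)
    (C : submodClosed M -> Prop) (z : tensor_free N M) :
  directed_system C -> is_union C ->
  exists2 S, C S & exists w : tensor_free N (submodule_type S), z = free_incl w.
Proof.
move=> C_directed C_union.
elim/freeg_int_ind: z => [|x y [S CS [v ->]] [T CT [w ->]]|[n m]].
- by have [S CS _] := C_union 0; exists S => //; exists 0; rewrite raddf0.
- have [V [CV SV TV]] := C_directed _ _ CS CT; exists V => //.
  exists (free_retr V (free_incl v) - free_retr V (free_incl w)).
  by rewrite raddfB /= !free_retrK.
have [S CS mS] := C_union m; exists S => //.
by exists << (n, Sub m mS) >>; rewrite free_inclU SubK.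
Qed.

(** * The Mittag-Leffler property on representatives *)

Lemma tensor_prod_map_pi (R : pzRingType) (I : Type) (N : I -> lmodType R^c)
    (M : lmodType R) (z : tensor_free (dprod N) M) (i : I) :
  tensor_prod_map (\pi_(Quotient.quot (@tensor_rels R (dprod N) M)) z) i
  = \pi_(Quotient.quot (@tensor_rels R (N i) M))
      (free_mapl (@dprod_proj _ _ N i) z).
Proof.
have mapB (x y : tensor (dprod N) M) :
    tensor_prod_map (x - y) = tensor_prod_map x - tensor_prod_map y.
  by apply/esym/eqP; rewrite subr_eq -tensor_prod_mapD subrK.
elim/freeg_int_ind: z => [|x y IHx IHy|[n m]].
- by rewrite raddf0 !raddf0 -[0](subrr (0 : tensor (dprod N) M)) mapB subrr.
- rewrite !raddfB /= mapB; congr (_ - _); [exact: IHx|exact: IHy].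
by rewrite free_maplU (tensor_prod_map_pure n m).
Qed.

Lemma Mittag_LefflerP (R : pzRingType) (K : lmodType R^c -> Prop)
    (M : lmodType R) :
  Mittag_Leffler K M <->
  forall (I : Type) (N : I -> lmodType R^c) (z : tensor_free (dprod N) M),
    (forall i, K (N i)) ->
    (forall i, free_mapl (@dprod_proj _ _ N i) z \in @tensor_rels R (N i) M) ->
    z \in @tensor_rels R (dprod N) M.
Proof.
split=> [ML I N z KN zN|ML I N KN x y xy].
  apply/pi_tensor_eq0/(ML I N KN); apply/functional_extensionality_dep => i.
  have -> : 0 = \pi_(Quotient.quot (@tensor_rels R (dprod N) M)) 0
    :> tensor (dprod N) M by rewrite raddf0.
  rewrite !tensor_prod_map_pi raddf0 raddf0; exact/pi_tensor_eq0.
apply/eqP; rewrite -subr_eq0 -[x - y]reprK; apply/eqP/pi_tensor_eq0.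
apply: ML => // i; apply/pi_tensor_eq0; rewrite -tensor_prod_map_pi reprK.
have := tensor_prod_mapD (x - y) y; rewrite subrK xy => /esym/eqP.
by rewrite -subr_eq0 addrK => /eqP ->.
Qed.

Theorem corollary3p11 (R : pzRingType) (K : lmodType R^c -> Prop)
    (M : lmodType R) (C : submodClosed M -> Prop)
    (C_directed : directed_system C) (C_omega : omega_closed C)
    (C_union : is_union C)
    (C_ML : forall S : submodClosed M, C S -> Mittag_Leffler K (submodule_type S)) :
  Mittag_Leffler K M.
Proof.
apply/Mittag_LefflerP => I N z KN zN.
have [S0 CS0 [w0 z_w0]] := free_incl_union z C_directed C_union.
pose A (S : {pred M}) i := rels_over S (free_mapl (@dprod_proj _ _ N i) z).
have A_mono (S T : {pred M}) : {subset S <= T} -> forall i, A S i -> A T i.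
  by move=> ST i; exact: rels_over_sub.
have vanish (J : Type) (h : J -> I) (S : submodClosed M) :
    C S -> {subset S0 <= S} -> (forall j, A S (h j)) ->
    rels_over S (free_mapl (@dprod_reindex _ _ N J h) z).
  (* Since [S] contains [S0], [z] is the image of a formal sum over [S], to which the Mittag-Leffler
     property of [S] applies for the family [N \o h]. *)
  move=> CS S0S AS; rewrite z_w0 -(free_retrK _ S0S) -z_w0.
  rewrite free_mapl_incl; apply/rels_over_incl.
  apply: (Mittag_LefflerP K _).1 => [|j|j]; [exact: C_ML|exact: KN|].
  apply/rels_over_incl; rewrite free_mapl_comp -free_mapl_incl.
  by rewrite {1}z_w0 free_retrK // -z_w0; exact: AS.
have [[S [CS S0S AS]]|no_full] :=
    pselect (exists S, [/\ C S, {subset S0 <= S} & forall i, A S i]).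
  apply/tensor_relsP/(rels_over_sub (U := S)) => //.
  suff <- : free_mapl (@dprod_reindex _ _ N I id) z = z by exact: vanish.
  elim/freeg_int_ind: {+}z => [|x y IHx IHy|[n m]]; first by rewrite raddf0.
    by rewrite raddfB /= IHx IHy.
  by rewrite free_maplU.
exfalso.
(* Bundling the invariants with the submodule lets a choice function be iterated from [S0]. *)
pose X := {S : submodClosed M | C S /\ {subset S0 <= S}}.
pose strict_ext (S T : X) := {subset sval S <= sval T} /\
  exists2 i, A (sval T) i & ~ A (sval S) i.
have [f fP] : {f : X -> X & forall S, strict_ext S (f S)}.
  apply: choice => -[S [CS S0S]] /=.
  have [i niS] : exists i, ~ A S i.
    by apply/existsNP => AS; apply: no_full; exists S.
  (* The relations for index [i] hold over all of [M], the union of [C], so a single member of [C]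
     already carries them. *)
  have [T CT AT] : exists2 T, C T & A T i.
    apply: (rels_over_directed (U := predT)) CS _ => //.
    exact/tensor_relsP/zN.
  have [V [CV SV TV]] := C_directed _ _ CS CT.
  have S0V : {subset S0 <= V} by move=> m /S0S/SV.
  exists (exist _ V (conj CV S0V)); split=> //=.
  by exists i => //; exact: A_mono AT.
pose s0 : X := exist _ S0 (conj CS0 (fun _ => id)).
pose s k := sval (iter k f s0).
have Cs k : C (s k) by case: (svalP (iter k f s0)).
have S0s k : {subset S0 <= s k} by case: (svalP (iter k f s0)).
have sS k : {subset s k <= s k.+1} by case: (fP (iter k f s0)).
have s_mono j k : (j <= k)%N -> {subset s j <= s k}.
  elim: k => [|k IHk]; first by rewrite leqn0 => /eqP ->.
  rewrite leq_eqVlt => /predU1P[-> //|]; rewrite ltnS => /IHk jk m /jk.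
  exact: sS.
have [|U CU Us] := C_omega s Cs.
  (* Were the inclusion an equality, monotonicity of [A] would give the new index [i] one step too
     early. *)
  move=> k; split=> // Ss; have [_ [i Ai nAi]] := fP (iter k f s0).
  by apply: nAi; exact: A_mono Ai.
have sU k : {subset s k <= U} by move=> m mk; apply/Us; exists k.
have [_ [k ->] zk] : exists2 S, (exists k, S = s k) &
    rels_over S (free_mapl (@dprod_reindex _ _ N {i | A U i} sval) z).
  apply: (rels_over_directed (U := U)) (ex_intro _ 0%N erefl) _.
  - move=> _ _ [j ->] [k ->]; exists (s (maxn j k)).
    by split; [exists (maxn j k)|apply/s_mono/leq_maxl|apply/s_mono/leq_maxr].
  - by move=> m /Us[k mk]; exists (s k) => //; exists k.
  - by apply: vanish => //; [move=> m /(S0s 0%N)/sU|case].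
have [_ [i Ai nAi]] := fP (iter k f s0).
apply: nAi; rewrite /A.
(* The index gained from [s k] to [s k.+1] lies in [A U], so projecting [zk] onto it gives
   [A (s k) i]. *)
pose j : {i | A U i} := exist _ i (A_mono _ _ (sU k.+1) _ Ai).
have := rels_over_mapl (@dprod_proj _ _ (N \o sval) j) zk.
by rewrite free_mapl_comp.
Qed.
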